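(* Suppose that $\mu(\Omega)<\infty$ and that the Orlicz function $\phi$ satisfies the $\Delta_2$-condition for all $x$. Let $u:\Omega\to\mathbb{C}$ be a measurable function inducing a multiplication operator $M_u$ on $L^\phi_\omega(\Omega)$. Then $M_u$ is invertible if and only if $u$ is invertible in $L^\infty(\mu)$.
   Context: $(\Omega,\Sigma,\mu)$ is a $\sigma$-finite complete measure space. $\tau:\Omega\to\Omega$ is a measurable transformation ($\tau^{-1}(A)\in\Sigma$ for all $A\in\Sigma$) which is nonsingular ($\mu(\tau^{-1}(A))=0$ whenever $\mu(A)=0$). The weight $\omega=\frac{d\mu\circ\tau^{-1}}{d\mu}$ is the Radon-Nikodym derivative of $\mu\circ\tau^{-1}$ with respect to $\mu$: a non-negative locally integrable function on $\Omega$ with $\mu(\tau^{-1}(A))=\int_A\omega\,d\mu$ for all $A\in\Sigma$. An Orlicz function is a continuous convex function $\phi:[0,\infty)\to[0,\infty)$ with $\phi(x)=0$ if and only if $x=0$, $\lim_{x\to0}\phi(x)/x=0$ and $\lim_{x\to\infty}\phi(x)/x=\infty$. It satisfies the $\Delta_2$-condition for all $x$ if there is $K>0$ with $\phi(2x)\le K\phi(x)$ for all $x>0$. $L^0(\Omega)$ is the linear space of ($\mu$-a.e. equivalence classes of) $\Sigma$-measurable complex-valued functions on $\Omega$. The weighted Orlicz space is $L^\phi_\omega(\Omega)=\{f\in L^0(\Omega):\int_\Omega\phi(\alpha|f|)\,\omega\,d\mu<\infty\text{ for some }\alpha>0\}$, with norm $\|f\|_{\phi,\omega}=\inf\{k>0:\int_\Omega\phi(|f|/k)\,\omega\,d\mu\le1\}$.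 For measurable $u$, $M_u$ is the linear transformation $f\mapsto u\cdot f$; it is called a multiplication operator (on $L^\phi_\omega(\Omega)$) when it is a continuous map of $L^\phi_\omega(\Omega)$ into itself. Invertible means invertible in the algebra of bounded linear operators on $L^\phi_\omega(\Omega)$.
   Formalization: The formal theorem additionally assumes that the weighted Orlicz norm is definite on μ-a.e. classes (in effect ω > 0 a.e.); when ω vanishes on a set of positive measure it is only a seminorm and the claim can fail, e.g. for τ(x)=x/2 on [0,1]. *)

(* Defs.v *)
From HB Require Import structures.
From mathcomp Require Import all_boot all_order all_algebra.
From mathcomp Require Import all_classical all_reals all_analysis.
From mathcomp Require Import ess_sup_inf complex.

Set Implicit Arguments.
Unset Strict Implicit.
Unset Printing Implicit Defensive.

Import Order.TTheory GRing.Theory Num.Theory.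
Import numFieldNormedType.Exports.
Import complex.ComplexField.

Local Open Scope classical_set_scope.
Local Open Scope ring_scope.

(* Elements of L^0, L^phi_w and L^oo are represented by measurable functions
   T -> R[i]; equality of classes is equality mu-almost everywhere. *)

(* phi is total on R, but only its values on [0, +oo[ are constrained or
   ever used. *)
Definition orlicz_function (R : realType) (phi : R -> R) : Prop :=
  (forall x, 0 <= x -> 0 <= phi x) /\
  {within `[0, +oo[, continuous phi} /\
  convex_function (`[0, +oo[ : set R^o) phi /\
  (forall x, 0 <= x -> (phi x = 0 <-> x = 0)) /\
  (fun x => phi x / x) @ 0^'+ --> (0 : R) /\
  (fun x => phi x / x) @ +oo --> +oo.

Definition Delta2 (R : realType) (phi : R -> R) : Prop :=
  exists2 K : R, 0 < K & forall x, 0 < x -> phi (2 * x) <= K * phi x.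

Definition nonsingular_transformation d (T : measurableType d) (R : realType)
    (mu : {measure set T -> \bar R}) (tau : T -> T) : Prop :=
  measurable_fun setT tau /\
  forall A, measurable A -> mu A = 0%E -> mu (tau @^-1` A) = 0%E.

(* w is a version of the Radon-Nikodym derivative of mu o tau^-1 with respect
   to mu. On an abstract measure space, "locally integrable" means integrable
   on the measurable sets of finite measure. *)
Definition RN_weight d (T : measurableType d) (R : realType)
    (mu : {measure set T -> \bar R}) (tau : T -> T) (w : T -> R) : Prop :=
  [/\ measurable_fun setT w,
      forall x, 0 <= w x,
      forall A, measurable A -> (mu A < +oo)%E -> mu.-integrable A (EFin \o w)
    & forall A, measurable A ->
        mu (tau @^-1` A) = (\int[mu]_(x in A) (w x)%:E)%E].

Section weighted_orlicz_space.
Context d (T : measurableType d) (R : realType).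
Variables (mu : {measure set T -> \bar R}) (phi : R -> R) (w : T -> R).
Implicit Types (f g u v : T -> R[i]) (S : (T -> R[i]) -> T -> R[i]).

Definition modulus f (x : T) : R := Normc.normc (f x).

Definition Cmeasurable f : Prop :=
  measurable_fun setT (fun x => complex.Re (f x)) /\
  measurable_fun setT (fun x => complex.Im (f x)).

Definition Orlicz_space : set (T -> R[i]) :=
  [set f | Cmeasurable f /\
     exists2 alpha : R, 0 < alpha &
       (\int[mu]_x (phi (alpha * modulus f x) * w x)%:E < +oo)%E].

Definition Orlicz_norm f : R :=
  inf [set k : R | 0 < k /\
    (\int[mu]_x (phi (modulus f x / k) * w x)%:E <= 1)%E].

(* The axiom by which Orlicz_norm is a norm, and not only a seminorm, on
   mu-a.e. classes. It fails when w vanishes on a set of positive measure. *)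
Definition Orlicz_norm_definite : Prop :=
  forall f, Orlicz_space f -> Orlicz_norm f = 0 -> {ae mu, forall x, f x = 0}.

Definition Orlicz_continuous S : Prop :=
  forall f, Orlicz_space f -> forall e : R, 0 < e ->
    exists2 delta : R, 0 < delta &
      forall g, Orlicz_space g -> Orlicz_norm (g \- f) < delta ->
        Orlicz_norm (S g \- S f) < e.

Definition bounded_linear_operator S : Prop :=
  [/\ forall f, Orlicz_space f -> Orlicz_space (S f),
      forall f g, Orlicz_space f -> Orlicz_space g ->
        {ae mu, forall x, f x = g x} -> {ae mu, forall x, S f x = S g x},
      forall (a : R[i]) f g, Orlicz_space f -> Orlicz_space g ->
        {ae mu, forall x, S (fun y => a * f y + g y) x = a * S f x + S g x}
    & exists C : R, forall f, Orlicz_space f ->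
        Orlicz_norm (S f) <= C * Orlicz_norm f].

Definition invertible_operator S : Prop :=
  bounded_linear_operator S /\
  exists2 S', bounded_linear_operator S' &
    forall f, Orlicz_space f ->
      {ae mu, forall x, S' (S f) x = f x} /\
      {ae mu, forall x, S (S' f) x = f x}.

Definition mul_op u : (T -> R[i]) -> T -> R[i] := fun f x => u x * f x.

Definition multiplication_operator u : Prop :=
  (forall f, Orlicz_space f -> Orlicz_space (mul_op u f)) /\
  Orlicz_continuous (mul_op u).

Definition Linfty u : Prop :=
  Cmeasurable u /\ (ess_sup mu (fun x => (modulus u x)%:E) < +oo)%E.

Definition Linfty_invertible u : Prop :=
  Linfty u /\ exists2 v, Linfty v & {ae mu, forall x, u x * v x = 1}.

End weighted_orlicz_space.

(* Main.v *)
(* The norm is monotone in the modulus, so an [L^oo] multiplier acts boundedly,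
   and an inverse of [u] in [L^oo] gives the inverse operator.  Conversely, test
   the operators on indicators, which have finite modular since
   [\int w dmu = mu (tau^-1 Omega) < +oo].  If [M_u] is bounded by [C] and
   [c > C], then [E = {|u| > c}] satisfies [c ||1_E|| <= C ||1_E||], so
   [1_E] has norm 0 and [E] is null because the norm is definite.  Bounding the
   inverse of [M_u] in the same way on [{c |u| <= 1}] bounds [|u|] away from 0. *)

Require Import Defs.
From HB Require Import structures.
From mathcomp Require Import all_boot all_order all_algebra.
From mathcomp Require Import all_classical all_reals all_analysis.
From mathcomp Require Import measurable_realfun ess_sup_inf complex.
From mathcomp Require Import ring lra.

Set Implicit Arguments.
Unset Strict Implicit.
Unset Printing Implicit Defensive.

Import Order.TTheory GRing.Theory Num.Theory.
Import numFieldNormedType.Exports.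
Import complex.ComplexField.

Local Open Scope classical_set_scope.
Local Open Scope ring_scope.

(** * Orlicz functions: convexity at the origin and monotonicity *)

Section orlicz_function_theory.
Context (R : realType) (phi : R -> R) (phiO : orlicz_function phi).

Lemma orlicz_ge0 x : 0 <= x -> 0 <= phi x.
Proof. by case: phiO => phi_ge0 _ /phi_ge0. Qed.

Lemma orlicz0 : phi 0 = 0.
Proof. by case: phiO => _ [_] [_] [phi_eq0 _]; apply/phi_eq0. Qed.

(** Convexity on the segment from 0 to [x]; the endpoint 0 contributes nothing because
    [phi 0 = 0]. *)
Lemma orlicz_scale t x : 0 <= t <= 1 -> 0 <= x -> phi (t * x) <= t * phi x.
Proof.
move=> t01 x_ge0; case: phiO => _ [_] [cvx _].
case/andP: t01 => t_ge0 t_le1.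
have mem y : 0 <= y -> y \in (`[0, +oo[%classic : set R).
  by move=> y_ge0; apply/mem_set; rewrite /= in_itv /= y_ge0.
have := cvx (Itv01 t_ge0 t_le1) x 0 (mem x x_ge0) (mem 0 (lexx 0)).
rewrite convRE /= orlicz0 mulr0 addr0.
suff <- : t * x + (1 - t) * 0 = t * x by [].
by rewrite mulr0 addr0.
Qed.

(** Write [x = (x / y) * y] with [x / y <= 1]: then [phi x <= (x / y) * phi y <= phi y]. The case
    [y = 0] forces [x = y]. *)
Lemma orlicz_le x y : 0 <= x -> x <= y -> phi x <= phi y.
Proof.
move=> x_ge0 xy; have y_ge0 := le_trans x_ge0 xy.
have [y0|y_neq0] := eqVneq y 0.
  by rewrite (_ : x = y)//; apply/eqP; rewrite eq_le xy y0 x_ge0.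
have y_gt0 : 0 < y by rewrite lt0r y_neq0.
have xy01 : 0 <= x / y <= 1 by rewrite divr_ge0//= ler_pdivrMr// mul1r.
rewrite -[x in phi x](divfK y_neq0) (le_trans (orlicz_scale xy01 y_ge0))//.
by case/andP: xy01 => _ ?; rewrite ler_piMl ?orlicz_ge0.
Qed.

End orlicz_function_theory.

(** * Measurability of products, moduli and inverses of complex functions *)

Section Cmeasurable_theory.
Context d (T : measurableType d) (R : realType).
Implicit Types (f g : T -> R[i]) (E : set T).

Lemma modulus_ge0 f x : 0 <= modulus f x.
Proof. by rewrite /modulus; case: (f x) => a b; exact: sqrtr_ge0. Qed.

Lemma modulusM f g x : modulus (fun y => f y * g y) x = modulus f x * modulus g x.
Proof. exact: Normc.normcM. Qed.

Lemma modulus_indic E x : modulus (fun y => (\1_E y)%:C%C) x = \1_E x :> R.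
Proof.
by rewrite /modulus /= expr0n/= addr0 sqrtr_sqr ger0_norm// indicE ler0n.
Qed.

Lemma Cmeasurable_indic E : measurable E -> Cmeasurable (fun x => (\1_E x : R)%:C%C).
Proof. by move=> mE; split => //=; exact: measurable_indic. Qed.

Lemma CmeasurableM f g : Cmeasurable f -> Cmeasurable g ->
  Cmeasurable (fun x => f x * g x).
Proof.
move=> [f1 f2] [g1 g2]; split.
- rewrite (_ : (fun _ => _) = (fun x => complex.Re (f x)) \* (fun x => complex.Re (g x))
    \- (fun x => complex.Im (f x)) \* (fun x => complex.Im (g x))).
    by apply: measurable_funB; exact: measurable_funM.
  by apply/funext => x /=; case: (f x) => a b; case: (g x).
- rewrite (_ : (fun _ => _) = (fun x => complex.Re (f x)) \* (fun x => complex.Im (g x))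
    \+ (fun x => complex.Im (f x)) \* (fun x => complex.Re (g x))).
    by apply: measurable_funD; exact: measurable_funM.
  by apply/funext => x /=; case: (f x) => a b; case: (g x).
Qed.

Lemma measurable_Cnorm2 f : Cmeasurable f ->
  measurable_fun setT (fun x => complex.Re (f x) ^+ 2 + complex.Im (f x) ^+ 2).
Proof. by move=> [f1 f2]; apply: measurable_funD; exact: measurable_funX. Qed.

Lemma measurable_modulus f : Cmeasurable f -> measurable_fun setT (modulus f).
Proof.
move=> /measurable_Cnorm2 mf.
rewrite (_ : modulus f = @powR R ^~ 2^-1 \o
    (fun x => complex.Re (f x) ^+ 2 + complex.Im (f x) ^+ 2)).
  by apply: measurableT_comp mf; exact: measurable_powR.
apply/funext => x /=; rewrite powR12_sqrt ?addr_ge0 ?sqr_ge0//.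
by rewrite /modulus; case: (f x).
Qed.

(** The inverse is the conjugate of [f x] divided by its squared modulus. This also covers zeros of
    [f], where both sides are 0. *)
Lemma CmeasurableV f : Cmeasurable f -> Cmeasurable (fun x => (f x)^-1).
Proof.
move=> mf; have [f1 f2] := mf.
have mV : measurable_fun setT
    (fun x => (complex.Re (f x) ^+ 2 + complex.Im (f x) ^+ 2)^-1).
  (* The power with exponent -1 is measurable and agrees with inversion on nonnegative reals, at 0
     included. *)
  rewrite (_ : (fun _ => _) = @powR R ^~ (-1) \o
      (fun x => complex.Re (f x) ^+ 2 + complex.Im (f x) ^+ 2)).
    by apply: measurableT_comp (measurable_Cnorm2 mf); exact: measurable_powR.
  by apply/funext => x /=; rewrite powR_inv1// addr_ge0 ?sqr_ge0.
split.
- rewrite (_ : (fun _ => _) = (fun x => complex.Re (f x)) \*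
    (fun x => (complex.Re (f x) ^+ 2 + complex.Im (f x) ^+ 2)^-1)).
    exact: measurable_funM.
  by apply/funext => x /=; case: (f x).
- rewrite (_ : (fun _ => _) = (\- (fun x => complex.Im (f x))) \*
    (fun x => (complex.Re (f x) ^+ 2 + complex.Im (f x) ^+ 2)^-1)).
    by apply: measurable_funM => //; exact: measurableT_comp.
  by apply/funext => x /=; case: (f x) => a b /=; rewrite mulNr.
Qed.

End Cmeasurable_theory.

(** * Monotonicity of the modular and of the norm; bounded multipliers *)

Section Orlicz_norm_theory.
Context d (T : measurableType d) (R : realType).
Context (mu : {measure set T -> \bar R}) (phi : R -> R) (w : T -> R).
Context (phiO : orlicz_function phi).
Context (mw : measurable_fun setT w) (w_ge0 : forall x, 0 <= w x).
Implicit Types (f g u : T -> R[i]) (E : set T).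

Local Notation space := (Orlicz_space mu phi w).
Local Notation norm := (Orlicz_norm mu phi w).

Lemma modular_integrand_ge0 f k x : 0 <= k -> (0 <= (phi (k * modulus f x) * w x)%:E)%E.
Proof.
by move=> k_ge0; rewrite lee_fin mulr_ge0// orlicz_ge0// mulr_ge0// modulus_ge0.
Qed.

Lemma measurable_modular_integrand f k : 0 <= k -> Cmeasurable f ->
  measurable_fun setT (fun x => (phi (k * modulus f x) * w x)%:E).
Proof.
move=> k_ge0 mf; apply/measurable_EFinP/measurable_funM => //.
rewrite -[X in measurable_fun _ X]/(phi \o (fun x => k * modulus f x)).
(* Continuity of [phi] is known only within [[0, +oo[], so the composition goes through that set,
   which contains the range of [k * modulus f]. *)
apply: (measurable_comp (F := `[0, +oo[%classic : set R)) => //.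
- move=> _ [x _ <-] /=.
  by rewrite in_itv/= andbT mulr_ge0 ?modulus_ge0.
- case: phiO => _ [cphi _]; apply: subspace_continuous_measurable_fun => //.
- by apply: measurable_funM => //; exact: measurable_modulus.
Qed.

(** The integrands compare almost everywhere, as [phi] is nondecreasing and [w] nonnegative. Keeping
    [a] inside the argument of [phi] serves both membership in the space and the norm estimate. *)
Lemma le_modular f g a k : 0 <= a -> 0 <= k -> Cmeasurable f -> Cmeasurable g ->
    {ae mu, forall x, a * modulus f x <= modulus g x} ->
  (\int[mu]_x (phi ((k * a) * modulus f x) * w x)%:E <=
   \int[mu]_x (phi (k * modulus g x) * w x)%:E)%E.
Proof.
move=> a_ge0 k_ge0 mf mg fg; have ka_ge0 := mulr_ge0 k_ge0 a_ge0.
apply: ae_ge0_le_integral => //.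
- by move=> x _; exact: modular_integrand_ge0.
- exact: measurable_modular_integrand.
- by move=> x _; exact: modular_integrand_ge0.
- exact: measurable_modular_integrand.
apply: filterS fg => x fg _; rewrite lee_fin ler_wpM2r// orlicz_le//.
  by rewrite mulr_ge0 ?modulus_ge0.
by rewrite -mulrA ler_wpM2l.
Qed.

Lemma Orlicz_space_le f g a : 0 < a -> Cmeasurable f -> space g ->
  {ae mu, forall x, a * modulus f x <= modulus g x} -> space f.
Proof.
move=> a_gt0 mf [mg [k k_gt0 kg]] fg; split => //.
exists (k * a); first exact: mulr_gt0.
by apply: le_lt_trans kg; apply: le_modular => //; exact: ltW.
Qed.

(* Convexity: [phi (t * y) <= t * phi y] for [0 <= t <= 1], and [t] may be taken so
   small that the modular at [1 / k = t * al] drops below 1. *)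
Lemma Orlicz_norm_set_nonempty g : space g ->
  exists2 k, 0 < k & (\int[mu]_x (phi (modulus g x / k) * w x)%:E <= 1)%E.
Proof.
move=> [mg [al al_gt0]].
set I := (\int[mu]_x _)%E => I_lty.
have I_ge0 : (0 <= I)%E.
  by apply: integral_ge0 => x _; apply: modular_integrand_ge0; exact: ltW.
have I_fin : I \is a fin_num by rewrite ge0_fin_numE.
set r := fine I; have r_ge0 : 0 <= r by exact: fine_ge0.
(* This gives [t * r <= 1]; the summand 1 also ensures [t <= 1] and covers [r = 0]. *)
pose t := (1 + r)^-1.
have t_gt0 : 0 < t by rewrite invr_gt0; lra.
have t_le1 : t <= 1 by rewrite invf_le1; lra.
exists (t * al)^-1; first by rewrite invr_gt0 mulr_gt0.
under eq_integral do rewrite invrK mulrC [in X in phi X]mulrC.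
apply: (@le_trans _ _ (\int[mu]_x (t%:E * (phi (al * modulus g x) * w x)%:E))%E).
  apply: ge0_le_integral => //.
  - by move=> x _; rewrite mulrC; apply: modular_integrand_ge0; rewrite mulr_ge0 ?ltW.
  - under eq_fun do rewrite mulrC.
    by apply: measurable_modular_integrand => //; rewrite mulr_ge0 ?ltW.
  - by apply: measurable_funeM; apply: measurable_modular_integrand => //; exact: ltW.
  - move=> x _; rewrite -EFinM lee_fin mulrC mulrA ler_wpM2r// -mulrA.
    by rewrite orlicz_scale ?mulr_ge0 ?modulus_ge0 ?t_le1 ?ltW.
rewrite ge0_integralZl//; last 3 first.
- by apply: measurable_modular_integrand => //; exact: ltW.
- by move=> x _; apply: modular_integrand_ge0; exact: ltW.
- by rewrite lee_fin ltW.
rewrite -/I -(fineK I_fin) -EFinM lee_fin -/r /t mulrC ler_pdivrMr; lra.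
Qed.

Lemma Orlicz_norm_ge0 f : space f -> 0 <= norm f.
Proof.
move=> /Orlicz_norm_set_nonempty [k k_gt0 kf].
by apply: lb_le_inf; [exists k|move=> y [/ltW]].
Qed.

(** If [k] is admissible in the infimum for [g], then [k / a] is admissible for [f], whence
    [a * norm f <= k]. *)
Lemma Orlicz_norm_le f g a : 0 < a -> Cmeasurable f -> space g ->
  {ae mu, forall x, a * modulus f x <= modulus g x} -> a * norm f <= norm g.
Proof.
move=> a_gt0 mf sg fg; have [k0 k0_gt0 k0g] := Orlicz_norm_set_nonempty sg.
apply: lb_le_inf; first by exists k0.
move=> k [k_gt0 kg]; rewrite mulrC -ler_pdivlMr//.
apply: ge_inf; first by exists 0 => y [/ltW].
split; first exact: divr_gt0.
apply: le_trans kg.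
have kV_ge0 : 0 <= k^-1 by rewrite invr_ge0 ltW.
have [mg _] := sg.
rewrite (_ : (fun x => (phi (modulus f x / (k / a)) * w x)%:E) =
             (fun x => (phi (k^-1 * a * modulus f x) * w x)%:E)); last first.
  by apply/funext => x; congr ((phi _ * _)%:E); rewrite invf_div; ring.
rewrite (_ : (fun x => (phi (modulus g x / k) * w x)%:E) =
             (fun x => (phi (k^-1 * modulus g x) * w x)%:E)); last first.
  by apply/funext => x; rewrite [k^-1 * _]mulrC.
by apply: le_modular => //; exact: ltW.
Qed.

(** An inverse operator returns the original function only almost everywhere, so its norm bound has
    to be transferred between representatives. *)
Lemma Orlicz_norm_ae_eq f g : Cmeasurable f -> space g ->
  {ae mu, forall x, g x = f x} -> norm f <= norm g.
Proof.
move=> mf sg gf; rewrite -[norm f]mul1r; apply: Orlicz_norm_le => //.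
by apply: filterS gf => x; rewrite mul1r /modulus => ->.
Qed.

Lemma Linfty_bounded u : Linfty mu u ->
  exists2 M, 0 < M & {ae mu, forall x, modulus u x <= M}.
Proof.
move=> [_ /ess_supr_bounded [M uM]].
(* The maximum with 1 makes the bound positive, so that it can be inverted. *)
exists (Num.max M 1); first by rewrite lt_max ltr01 orbT.
by apply: filterS uM => x ?; rewrite le_max; apply/orP; left.
Qed.

Lemma bounded_Linfty u M : Cmeasurable u ->
  {ae mu, forall x, modulus u x <= M} -> Linfty mu u.
Proof.
move=> u_meas uM; split => //; apply: (@le_lt_trans _ _ M%:E); last exact: ltry.
by apply/ess_supP; apply: filterS uM => x; rewrite lee_fin.
Qed.

Lemma Linfty_mul_op_bounded u : Linfty mu u ->
  bounded_linear_operator mu phi w (mul_op u).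
Proof.
move=> Lu; have [u_meas _] := Lu; have [M M_gt0 uM] := Linfty_bounded Lu.
have MV_gt0 : 0 < M^-1 by rewrite invr_gt0.
have uf_le f : {ae mu, forall x, M^-1 * modulus (mul_op u f) x <= modulus f x}.
  apply: filterS uM => x ux; rewrite modulusM mulrA ler_piMl ?modulus_ge0//.
  by rewrite mulrC ler_pdivrMr// mul1r.
have muf f : space f -> Cmeasurable (mul_op u f) by case => mf _; exact: CmeasurableM.
split.
- by move=> f sf; apply: (Orlicz_space_le MV_gt0) (uf_le f) => //; exact: muf.
- by move=> f g _ _; apply: filterS => x fg; rewrite /mul_op fg.
- by move=> a f g _ _; apply: nearW => x; rewrite /mul_op mulrDr mulrCA.
- exists M => f sf; rewrite mulrC -ler_pdivrMr// mulrC.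
  by apply: Orlicz_norm_le (uf_le f) => //; exact: muf.
Qed.

Lemma Linfty_invertible_mul_op u : Linfty_invertible mu u ->
  invertible_operator mu phi w (mul_op u).
Proof.
move=> [Lu [v Lv uv1]]; split; first exact: Linfty_mul_op_bounded.
exists (mul_op v); first exact: Linfty_mul_op_bounded.
move=> f sf; split; apply: filterS uv1 => x uvx; rewrite /mul_op mulrA.
- by rewrite [v x * _]mulrC uvx mul1r.
- by rewrite uvx mul1r.
Qed.

(** * From operator bounds to essential bounds, by testing on indicators *)

Section definite.
Context (w_fin : (\int[mu]_x (w x)%:E < +oo)%E).
Context (norm_definite : Orlicz_norm_definite mu phi w).

Let ind E : T -> R[i] := fun x => (\1_E x)%:C%C.

Lemma Orlicz_space_indic E : measurable E -> space (ind E).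
Proof.
move=> mE; have mI := Cmeasurable_indic R mE; split => //; exists 1 => //.
(* An indicator is at most 1, so monotonicity of [phi] dominates the integrand by [phi 1 * w]. *)
apply: (@le_lt_trans _ _ (\int[mu]_x ((phi 1)%:E * (w x)%:E))%E).
  apply: ge0_le_integral => //.
  - by move=> x _; exact: modular_integrand_ge0.
  - exact: measurable_modular_integrand.
  - by apply: measurable_funeM; exact/measurable_EFinP.
  - move=> x _; rewrite -EFinM lee_fin ler_wpM2r// mul1r modulus_indic.
    by rewrite orlicz_le// indicE ?ler0n// lern1 leq_b1.
rewrite ge0_integralZl//; last 3 first.
- exact/measurable_EFinP.
- by move=> x _; rewrite lee_fin.
- by rewrite lee_fin orlicz_ge0.
by apply: lte_mul_pinfty; rewrite // lee_fin orlicz_ge0.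
Qed.

Lemma ae_notin_of_norm_indic_le0 E : measurable E -> norm (ind E) <= 0 ->
  {ae mu, forall x, ~ E x}.
Proof.
move=> mE nE; have sE := Orlicz_space_indic mE.
have : norm (ind E) = 0 by apply/eqP; rewrite eq_le nE Orlicz_norm_ge0.
move=> /(norm_definite sE); apply: filterS => x + Ex.
by rewrite /ind indicE mem_set//= => /eqP; rewrite eq_complex /= oner_eq0.
Qed.

Lemma bounded_mul_op_Linfty u : Cmeasurable u ->
  bounded_linear_operator mu phi w (mul_op u) -> Linfty mu u.
Proof.
(* [C] may be negative; this [c] is positive and strictly above [C], and the strict gap forces the
   norm of the indicator to be at most 0. *)
move=> u_meas [us _ _ [C uC]]; pose c := `|C| + 1.
have Cc : C < c by rewrite /c ltr_pwDr// ler_norm.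
have c_gt0 : 0 < c by rewrite /c ltr_wpDl.
pose E := [set x | c < modulus u x].
have mE : measurable E.
  rewrite (_ : E = setT `&` modulus u @^-1` `]c, +oo[).
    exact: measurable_modulus.
  by rewrite setTI; apply/funext => x /=; rewrite in_itv/= andbT.
have sE := Orlicz_space_indic mE.
have : {ae mu, forall x, ~ E x}.
  apply: ae_notin_of_norm_indic_le0 => //.
  suff : c * norm (ind E) <= C * norm (ind E).
    by rewrite -subr_ge0 -mulrBl nmulr_rge0// subr_lt0.
  apply: le_trans (uC _ sE); apply: Orlicz_norm_le => //.
  - by case: sE.
  - exact: us.
  apply: nearW => x; rewrite modulusM modulus_indic indicE.
  by have [/set_mem /ltW|_] := boolP (x \in E); rewrite ?mulr1 ?mulr0.
move=> EN; apply: (bounded_Linfty (M := c)) => //.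
by apply: filterS EN => x /negP; rewrite -leNgt.
Qed.

Lemma invertible_mul_op_bounded_below u : Cmeasurable u ->
    invertible_operator mu phi w (mul_op u) ->
  exists2 c, 0 < c & {ae mu, forall x, 1 < c * modulus u x}.
Proof.
move=> u_meas [[us _ _ _] [S' [S's _ _ [C S'C]] S'u]]; pose c := `|C| + 1.
have Cc : C < c by rewrite /c ltr_pwDr// ler_norm.
have c_gt0 : 0 < c by rewrite /c ltr_wpDl.
(* The inequality is not strict, so that off [E] the modulus of [u] exceeds [1 / c]. *)
exists c => //; pose E := [set x | c * modulus u x <= 1].
have mE : measurable E.
  rewrite (_ : E = setT `&` (fun x => c * modulus u x) @^-1` `]-oo, 1]).
    by apply: measurable_funM => //; exact: measurable_modulus.
  by rewrite setTI; apply/funext => x /=; rewrite in_itv/=.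
have sE := Orlicz_space_indic mE.
have [S'uE _] := S'u _ sE.
have suE := us _ sE; have uE_ge0 := Orlicz_norm_ge0 suE.
have uE_le : c * norm (mul_op u (ind E)) <= norm (ind E).
  apply: Orlicz_norm_le => //; first by case: suE.
  apply: nearW => x; rewrite modulusM modulus_indic indicE.
  by have [/set_mem /=|_] := boolP (x \in E); rewrite ?mulr1 ?mulr0.
have E_le : norm (ind E) <= C * norm (mul_op u (ind E)).
  apply: le_trans (S'C _ suE); apply: Orlicz_norm_ae_eq => //; first by case: sE.
  exact: S's.
(* The two bounds give [c * N <= C * N] for this norm [N], with [C < c], hence [N = 0]; then [E_le]
   yields [norm (ind E) <= 0]. *)
have uE0 : norm (mul_op u (ind E)) = 0.
  apply/eqP; rewrite eq_le uE_ge0 andbT.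
  have := le_trans uE_le E_le.
  by rewrite -subr_ge0 -mulrBl nmulr_rge0// subr_lt0.
have : {ae mu, forall x, ~ E x}.
  by apply: ae_notin_of_norm_indic_le0 => //; rewrite uE0 mulr0 in E_le.
by apply: filterS => x /negP; rewrite -ltNge.
Qed.

Lemma invertible_mul_op_Linfty u : Cmeasurable u ->
  invertible_operator mu phi w (mul_op u) -> Linfty_invertible mu u.
Proof.
move=> u_meas invu; split; first by apply: bounded_mul_op_Linfty => //; case: invu.
have [c c_gt0 uc] := invertible_mul_op_bounded_below u_meas invu.
have u_gt0 : {ae mu, forall x, 0 < modulus u x}.
  by apply: filterS uc => x /(lt_trans ltr01); rewrite pmulr_rgt0.
(* Where [u] vanishes this takes the value 0, but [u_gt0] makes that set null; elsewhere [uc] bounds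
   the inverse by [c]. *)
exists (fun x => (u x)^-1).
- apply: (bounded_Linfty (M := c)); first exact: CmeasurableV.
  apply: filterS2 uc u_gt0 => x ucx ux; rewrite /modulus Normc.normcV.
  by rewrite -[_^-1]mul1r ler_pdivrMr// ltW.
- apply: filterS u_gt0 => x ux; apply: divff.
  by apply: contraTneq ux => ux; rewrite /modulus ux Normc.normc0 ltxx.
Qed.

End definite.

End Orlicz_norm_theory.

Theorem corollary3p7 (d : measure_display) (T : measurableType d)
    (R : realType) (mu : {sigma_finite_measure set T -> \bar R})
    (mu_complete : measure_is_complete mu)
    (mu_finite : (mu setT < +oo)%E)
    (tau : T -> T) (tau_ns : nonsingular_transformation mu tau)
    (w : T -> R) (w_RN : RN_weight mu tau w)
    (phi : R -> R) (phi_orlicz : orlicz_function phi) (phi_D2 : Delta2 phi)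
    (norm_definite : Orlicz_norm_definite mu phi w)
    (u : T -> R[i]) (u_meas : Cmeasurable u)
    (u_mult : multiplication_operator mu phi w u) :
  invertible_operator mu phi w (mul_op u) <-> Linfty_invertible mu u.
Proof.
have [mw w_ge0 _ tauE] := w_RN.
(* Applying the weight identity to the whole space gives the total mass of [mu], since the preimage
   of [setT] is [setT]. *)
have w_fin : (\int[mu]_x (w x)%:E < +oo)%E.
  by rewrite -tauE// preimage_setT.
split.
- exact: invertible_mul_op_Linfty.
- exact: Linfty_invertible_mul_op.
Qed.
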